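(* Let $A\in BL(X)$ and $Ax-zx=y$, where $x,y\in X$ and $z\notin\sigma(A)$. Further let $\delta x$ be a perturbation of the solution $x$ corresponding to the perturbation $\Delta A$ of $A$, i.e. $(A-zI+\Delta A)(x+\delta x)=y$. Define $\kappa(z,A):=\sup\{0<\epsilon<1: z\notin\sigma_\epsilon(A)\}$, and define $\kappa(z,A+\Delta A)$ in the same way with $A+\Delta A$ in place of $A$. Then (1) $\displaystyle \frac{\|\delta x\|}{\|x\|}\le \frac{2\|\Delta A\|}{M_1\,\kappa(z,A+\Delta A)}$, where $M_1:=\sup\{\|A+\Delta A-\lambda I\|:\lambda\in\sigma(A+\Delta A)\}$; (2) $\displaystyle \frac{\|\delta x\|}{\|x+\delta x\|}\le \frac{2\|\Delta A\|}{M_2\,\kappa(z,A)}$, where $M_2:=\sup\{\|A-\lambda I\|:\lambda\in\sigma(A)\}$.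
   Context: $X$ is a complex Banach space and $BL(X)$ is the Banach algebra of all bounded linear operators on $X$, with identity $I$. The spectrum of $A\in BL(X)$ is $\sigma(A)=\{z\in\mathbb{C}: A-zI \text{ is not invertible}\}$. For $0<\epsilon<1$ the $\epsilon$-condition pseudospectrum of $A$ is $$\sigma_\epsilon(A)=\sigma(A)\cup\{z\in\mathbb{C}: \|A-zI\|\,\|(A-zI)^{-1}\|\ge \epsilon^{-1}\}.$$ *)

(* Defs.v *)
From HB Require Import structures.
From mathcomp Require Import all_boot all_order all_algebra.
From mathcomp Require Import all_classical all_reals.
From mathcomp Require Import topology normedtype.
From mathcomp Require Export complex.

Set Implicit Arguments.
Unset Strict Implicit.
Unset Printing Implicit Defensive.

Import Order.TTheory GRing.Theory Num.Theory.
Import numFieldNormedType.Exports.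

Local Open Scope classical_set_scope.
Local Open Scope ring_scope.

(* A complex Banach space is [X : completeNormedModType R[i]] with
   [R : realType].  Operators are plain functions [X -> X], whose pointwise
   sums and scalings come from the left-module structure on functions;
   [bounded_op] carves out BL(X). *)
Section operators.
Context {R : realType} {X : completeNormedModType R[i]}.
Implicit Types (A B : X -> X) (z : R[i]) (e : R) (x : X).

(* The library norm of [X] takes its (real, nonnegative) values in R[i]. *)
Definition rnorm x : R := complex.Re `|x|.

Definition bounded_op A :=
  linear A /\ exists M : R, forall x, rnorm (A x) <= M * rnorm x.

Definition opnorm A : R := sup [set rnorm (A x) | x in [set x | rnorm x <= 1]].

Definition op_inverse A B := [/\ bounded_op B, A \o B = id & B \o A = id].

Definition op_invertible A := exists B, op_inverse A B.

(* Two-sided inverses are unique; the value is [A] itself (junk) when [A] is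
   not invertible. *)
Definition opinv A : X -> X := xget A (op_inverse A).

Definition shift_op A z : X -> X := A - z *: (id : X -> X).

Definition spectrum A : set R[i] := [set z | ~ op_invertible (shift_op A z)].

(* The junk value of [opinv] is harmless: it only occurs on [spectrum A]. *)
Definition cond_pseudospectrum e A : set R[i] :=
  spectrum A `|`
  [set z | e^-1 <= opnorm (shift_op A z) * opnorm (opinv (shift_op A z))].

(* As [sup set0 = 0], this is [0] when [z] lies in [spectrum A]. *)
Definition kappa z A : R :=
  sup [set e | 0 < e < 1 /\ ~ cond_pseudospectrum e A z].

Definition spectral_sup A : R :=
  sup [set opnorm (shift_op A l) | l in spectrum A].

End operators.

(* Main.v *)
(* Put [S := A - z].  In (1), [(S + DA) dx = - DA x]; in (2),
   [S dx = - DA (x + dx)].  Hence the relative error is at most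
   [||T^-1|| ||DA||], where [T] is [S + DA] in (1) and [S] in (2).  If
   [B - z = T], then [kappa z B * ||T|| ||T^-1|| <= 1], and every [l] in the
   spectrum of [B] satisfies [|l - z| <= ||T||], so
   [spectral_sup B <= 2 ||T||]; multiplying gives
   [spectral_sup B * kappa z B * ||T^-1|| <= 2].  When [T] is not invertible
   (possible only in (1), with [DA <> 0]), [kappa z B = 0] and the right-hand
   side is [+oo]. *)
Require Import Defs.
From HB Require Import structures.
From mathcomp Require Import all_boot all_order all_algebra.
From mathcomp Require Import all_classical all_reals.
From mathcomp Require Import topology normedtype sequences.
Import Order.TTheory GRing.Theory Num.Theory.
Import numFieldNormedType.Exports.
Local Open Scope ring_scope.

Section complex_banach.
Set Implicit Arguments.
Unset Strict Implicit.
Local Open Scope classical_set_scope.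
Local Open Scope ring_scope.
Context {R : realType} {X : completeNormedModType R[i]}.
Implicit Types (A B S : X -> X) (c l z : R[i]) (x y : X).

(** * The real-valued norm *)

Lemma rnormE x : `|x| = ((rnorm x)%:C)%C.
Proof. by rewrite /rnorm RRe_real ?normr_real. Qed.

Lemma rnorm_ge0 x : 0 <= rnorm x.
Proof. by rewrite -lecR -rnormE rmorph0. Qed.

Lemma rnorm0 : rnorm (0 : X) = 0.
Proof. by rewrite /rnorm normr0. Qed.

Lemma rnorm_le0 x : rnorm x <= 0 -> x = 0.
Proof. by rewrite -lecR -rnormE rmorph0 normr_le0 => /eqP. Qed.

Lemma rnormD x y : rnorm (x + y) <= rnorm x + rnorm y.
Proof. by rewrite -lecR rmorphD /= -!rnormE ler_normD. Qed.

Lemma rnormN x : rnorm (- x) = rnorm x.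
Proof. by rewrite /rnorm normrN. Qed.

Lemma rnormZ c x : rnorm (c *: x) = complex.Re `|c| * rnorm x.
Proof.
by rewrite /rnorm normrZ rnormE; case: `|c| => a b /=; rewrite mulr0 subr0.
Qed.

Lemma Re_norm_ge0 c : 0 <= complex.Re `|c|.
Proof. by rewrite -lecR RRe_real ?normr_real ?rmorph0. Qed.

Lemma Re_normV c : complex.Re `|c^-1| = (complex.Re `|c|)^-1.
Proof. by rewrite normfV normc_def -fmorphV. Qed.

(** * Bounded operators and the operator norm *)

Lemma bounded_opD A B : bounded_op A -> bounded_op B -> bounded_op (A + B).
Proof.
move=> [lA [M AM]] [lB [N BN]]; split.
  by move=> a x y; rewrite !fctE lA lB scalerDr addrACA.
by exists (M + N) => x; rewrite mulrDl (le_trans (rnormD _ _))// lerD.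
Qed.

Lemma bounded_op_shift A z : bounded_op A -> bounded_op (shift_op A z).
Proof.
move=> bA; apply: bounded_opD => //; split.
  move=> a x y /=; rewrite !fctE scalerDr opprD scalerN; congr (_ - _).
  by rewrite !scalerA mulrC.
by exists (complex.Re `|z|) => x; rewrite /= !fctE rnormN rnormZ.
Qed.

Lemma bounded_op0 A : bounded_op A -> A 0 = 0.
Proof.
by move=> [lA _]; have := lA (-1) 0 0; rewrite scaler0 addr0 scaleN1r addNr.
Qed.

Lemma bounded_opZ A c x : bounded_op A -> A (c *: x) = c *: A x.
Proof. by move=> bA; have := bA.1 c x 0; rewrite !addr0 bounded_op0 ?addr0. Qed.

Lemma bounded_opB A x y : bounded_op A -> A (x - y) = A x - A y.
Proof.
by move=> bA; rewrite addrC -scaleN1r bA.1 scaleN1r addrC.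
Qed.

Lemma opnorm_has_sup A : bounded_op A ->
  has_sup [set rnorm (A x) | x in [set x | rnorm x <= 1]]%classic.
Proof.
move=> bA; split; first by exists (rnorm (A 0)), 0 => //=; rewrite rnorm0.
(* On the trivial space [M] may be negative, hence [|M|]. *)
have [_ [M AM]] := bA; exists `|M| => _ [x /= x1 <-].
rewrite (le_trans (AM x))// (le_trans (ler_wpM2r (rnorm_ge0 x) (ler_norm M)))//.
by rewrite ler_piMr.
Qed.

Lemma opnorm_ge0 A : bounded_op A -> 0 <= opnorm A.
Proof.
move=> bA; rewrite (le_trans (rnorm_ge0 (A 0)))//.
apply: sup_upper_bound; first exact: opnorm_has_sup.
by exists 0 => //=; rewrite rnorm0.
Qed.

Lemma le_opnorm A x : bounded_op A -> rnorm (A x) <= opnorm A * rnorm x.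
Proof.
move=> bA; have [->|x0] := eqVneq x 0; first by rewrite bounded_op0// rnorm0 mulr0.
have nx : 0 < rnorm x.
  rewrite lt_neqAle rnorm_ge0 andbT eq_sym; apply: contra_neq x0 => n0.
  by apply: rnorm_le0; rewrite n0.
rewrite -ler_pdivrMr//; apply: sup_upper_bound; first exact: opnorm_has_sup.
(* Dividing by [rnorm x] moves [x] into the unit ball, where the supremum applies. *)
have E y : rnorm (((rnorm x)^-1%:C)%C *: y) = rnorm y / rnorm x.
  rewrite rnormZ normc_def /= expr0n addr0 sqrtr_sqr mulrC.
  by rewrite ger0_norm ?invr_ge0 ?rnorm_ge0.
exists (((rnorm x)^-1%:C)%C *: x) => /=; first by rewrite E divff// gt_eqF.
by rewrite bounded_opZ.
Qed.

Lemma opnorm_le A (C : R) :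
  0 <= C -> (forall x, rnorm (A x) <= C * rnorm x) -> opnorm A <= C.
Proof.
move=> C0 AC; apply: ge_sup; first by exists (rnorm (A 0)), 0 => //=; rewrite rnorm0.
by move=> _ [x /= x1 <-]; rewrite (le_trans (AC x))// ler_piMr.
Qed.

Lemma opnorm_shift_le A z :
  bounded_op A -> opnorm (shift_op A z) <= opnorm A + complex.Re `|z|.
Proof.
move=> bA; apply: opnorm_le => [|x]; first by rewrite addr_ge0 ?opnorm_ge0 ?Re_norm_ge0.
rewrite /shift_op !fctE (le_trans (rnormD _ _))// rnormN rnormZ mulrDl.
by rewrite lerD2r le_opnorm.
Qed.

(** * Contraction principle and invertibility far from the spectrum *)

(* [banach_fixed_point] in [sequences] only covers spaces over a [realType]. *)
Lemma complex_banach_fixed_point (f : X -> X) (q : R) : 0 <= q < 1 ->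
  (forall x y, rnorm (f x - f y) <= q * rnorm (x - y)) -> exists p, f p = p.
Proof.
move=> /andP[q0 q1] fq; pose u n := iter n f 0.
have q1' : 0 < 1 - q by rewrite subr_gt0.
(* [C] sums the geometric series of step lengths; [C = D + q * C] closes the induction in [uC]. *)
pose D := rnorm (u 0%N - u 1%N); pose C := D / (1 - q).
have uC m : rnorm (u 0%N - u m) <= C.
  elim: m => [|m ih]; first by rewrite subrr rnorm0 divr_ge0 ?rnorm_ge0 ?ltW.
  rewrite -(subrKA (u 1%N)) (le_trans (rnormD _ _))//.
  have -> : C = D + q * C.
    by rewrite -[D](divfK (lt0r_neq0 q1')) -/C mulrC -mulrDl subrK mul1r.
  by rewrite lerD2l (le_trans (fq _ _))// ler_wpM2l.
have uqC n m : rnorm (u n - u (n + m)%N) <= q ^+ n * C.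
  elim: n => [|n ih]; first by rewrite expr0 mul1r.
  by rewrite addSn exprS -mulrA (le_trans (fq _ _))// ler_wpM2l.
have qC0 : (fun n => q ^+ n * C) @ \oo --> (0 : R).
  by rewrite -[0](mul0r C); apply: cvgMr_tmp; apply: cvg_expr; rewrite ger0_norm.
have cu : cvgn u.
  apply: cauchy_cvg; apply/cauchy_ballP => e e0; near_simpl.
  (* The order on [R[i]] compares only numbers with equal imaginary parts, so a positive [e] is
     real. *)
  have [r r0 eE] : exists2 r : R, 0 < r & e = (r%:C)%C.
    move: e0; case: (e) => a b; rewrite ltcE /= => /andP[/eqP -> a0].
    by exists a.
  have [N _ HN] : \forall n \near \oo, q ^+ n * C < r.
    by move/cvgr_lt: qC0; apply.
  have bal n m : (N <= n)%N -> (n <= m)%N -> ball (u n) e (u m).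
    move=> Nn nm; rewrite -ball_normE /= rnormE eE ltcR -(subnKC nm).
    exact: le_lt_trans (uqC _ _) (HN _ Nn).
  near=> n m.
  have Nn : (N <= n)%N by near: n; exists N.
  have Nm : (N <= m)%N by near: m; exists N.
  have [nm|/ltnW mn] := leqP n m; first exact: bal.
  by apply: ball_sym; exact: bal.
exists (limn u); apply: subr0_eq; apply: rnorm_le0; apply/ler_addgt0Pr => e e0.
have e2 : 0 < ((e / 2)%:C)%C by rewrite ltcR divr_gt0.
have [N _ HN] : \forall n \near \oo, `|limn u - u n| < ((e / 2)%:C)%C.
  by move/cvgrPdist_lt: cu; apply.
have H n : (N <= n)%N -> rnorm (limn u - u n) <= e / 2.
  by move=> /HN /=; rewrite rnormE ltcR => /ltW.
(* Since [u N.+1 = f (u N)], both [f (limn u)] and [limn u] are within [e / 2] of it. *)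
rewrite add0r -(subrKA (u N.+1)) (le_trans (rnormD _ _))// [leRHS]splitr lerD//.
  by rewrite (le_trans (fq _ _))// (le_trans _ (H N _))// ler_piMl ?rnorm_ge0 ?ltW.
by rewrite -rnormN opprB H.
Unshelve. all: end_near. Qed.

(** Solving [S x - c *: x = y] means finding a fixed point of [c^-1 *: (S x - y)], a contraction of
    ratio [opnorm S / k], where [k] is the modulus of [c]. *)
Lemma op_invertible_shift S c :
  bounded_op S -> opnorm S < complex.Re `|c| -> op_invertible (shift_op S c).
Proof.
move=> bS Sc; set k := complex.Re `|c| in Sc.
have k0 : 0 < k := le_lt_trans (opnorm_ge0 bS) Sc.
have c0 : c != 0 by apply/eqP => c0; move: k0; rewrite /k c0 normr0 ltxx.
have bT := bounded_op_shift c bS; set T := shift_op S c in bT *.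
have solve y : exists x, T x = y.
  have [||p pE] := @complex_banach_fixed_point (fun x => c^-1 *: (S x - y)) (opnorm S / k).
  - by rewrite divr_ge0 ?opnorm_ge0 ?ltW//= ltr_pdivrMr// mul1r.
  - move=> x1 x2; rewrite -scalerBr opprB addrA subrK -(bounded_opB _ _ bS) rnormZ Re_normV -/k.
    by rewrite [leRHS]mulrAC mulrC ler_wpM2r ?invr_ge0 ?(ltW k0)// le_opnorm.
  exists p; rewrite /T /shift_op !fctE -[in c *: _]pE scalerA divff// scale1r.
  by rewrite opprB addrC subrK.
(* The reverse triangle inequality bounds [T] from below, which gives both injectivity and the bound
   on the inverse. *)
have below x : rnorm x * (k - opnorm S) <= rnorm (T x).
  rewrite mulrBr lerBlDr mulrC -rnormZ -rnormN.
  have -> : - (c *: x) = T x - S x by rewrite /T /shift_op !fctE addrAC subrr add0r.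
  by rewrite (le_trans (rnormD _ _))// rnormN lerD2l mulrC le_opnorm.
have kS : 0 < k - opnorm S by rewrite subr_gt0.
have injT : injective T.
  move=> x y xy; apply: subr0_eq; apply: rnorm_le0.
  by rewrite -(pmulr_lle0 _ kS) (le_trans (below _))// bounded_opB// xy subrr rnorm0.
have [g gE] := choice solve.
exists g; split.
- split=> [a x y|]; first by apply: injT; rewrite gE bT.1 !gE.
  by exists (k - opnorm S)^-1 => x; rewrite mulrC ler_pdivlMr// -{2}(gE x).
- by apply/funext => x /=; rewrite gE.
- by apply/funext => x /=; apply: injT; rewrite gE.
Qed.

(** * Estimates for [spectral_sup] and [kappa] *)

Lemma shift_opB A z l : shift_op (shift_op A z) (l - z) = shift_op A l.
Proof.
by apply/funext => x; rewrite /shift_op !fctE scalerBl opprB addrA subrK.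
Qed.

Lemma op_inverse_opinv A : op_invertible A -> op_inverse A (opinv A).
Proof. exact: xgetPex. Qed.

Lemma spectral_sup_ge0 A : bounded_op A -> 0 <= spectral_sup A.
Proof.
move=> bA; rewrite /spectral_sup; set E := (X in sup X).
(* A set without a supremum has [sup] equal to 0. *)
have [hE|/sup_out->//] := pselect (has_sup E).
have [[e [l sl le]] _] := hE; rewrite (le_trans (opnorm_ge0 (bounded_op_shift l bA)))//.
by apply: sup_upper_bound => //; exists l.
Qed.

(* The operator [A - l] is [(A - z) - (l - z)], which is invertible when
   [|l - z| > opnorm (A - z)]; so [|l - z| <= opnorm (A - z)] on the spectrum. *)
Lemma spectral_sup_le A z :
  bounded_op A -> spectral_sup A <= 2 * opnorm (shift_op A z).
Proof.
move=> bA; have bS := bounded_op_shift z bA; rewrite /spectral_sup; set E := (X in sup X).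
have [->|/set0P E0] := eqVneq E set0; first by rewrite sup0 mulr_ge0 ?opnorm_ge0.
apply: ge_sup => // _ [l sl <-].
rewrite -(shift_opB A z l) (le_trans (opnorm_shift_le _ bS))// mulr_natl mulr2n lerD2l.
rewrite leNgt; apply/negP => /(op_invertible_shift bS); rewrite shift_opB; exact: sl.
Qed.

Lemma kappa_ge0 z A : 0 <= kappa z A.
Proof.
rewrite /kappa; set E := (X in sup X).
have [->|/set0P [e Ee]] := eqVneq E set0; first by rewrite sup0.
have [/andP[e0 _] _] := Ee; rewrite (le_trans (ltW e0))//; apply: ub_le_sup => //.
by exists 1 => d [/andP[_ /ltW]].
Qed.

Lemma kappa_le z A : bounded_op A ->
  kappa z A * (opnorm (shift_op A z) * opnorm (opinv (shift_op A z))) <= 1.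
Proof.
move=> bA; set p := opnorm _ * _; have [p0|p0] := leP p 0.
  by rewrite (le_trans _ ler01)// mulr_ge0_le0// kappa_ge0.
rewrite -ler_pdivlMr// /kappa; set E := (X in sup X).
have [->|/set0P E0] := eqVneq E set0; first by rewrite sup0 mul1r invr_ge0 ltW.
apply: ge_sup => // e [/andP[e0 _] ne]; rewrite mul1r -[e]invrK lef_pV2 ?posrE ?invr_gt0//.
by rewrite leNgt; apply/negP => pe; apply: ne; right; exact: ltW.
Qed.

Lemma kappa_spectrum z A : spectrum A z -> kappa z A = 0.
Proof.
move=> sz; rewrite /kappa; set E := (X in sup X).
suff -> : E = set0 by rewrite sup0.
by apply/seteqP; split=> // e [_ []]; left.
Qed.

(** * The perturbation estimate *)

(* If [z] is in the spectrum, then [kappa z A = 0] and the right-hand side is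
   [+oo] as soon as [B <> 0]; this is why only [B = 0] needs excluding. *)
Lemma perturbation_bound A B z x y :
  bounded_op A -> bounded_op B -> (B = 0 -> ~ spectrum A z) ->
  shift_op A z x = - B y ->
  ((rnorm x)%:E / (rnorm y)%:E <=
   (2 * opnorm B)%:E / (spectral_sup A * kappa z A)%:E)%E.
Proof.
move=> bA bB nz Sx; have bS := bounded_op_shift z bA; set S := shift_op A z in bS Sx.
have B0 := opnorm_ge0 bB.
have m0 : 0 <= spectral_sup A * kappa z A by rewrite mulr_ge0 ?spectral_sup_ge0 ?kappa_ge0.
have x0 : ~ spectrum A z -> rnorm x <= opnorm (opinv S) * (opnorm B * rnorm y).
  move=> /contrapT/op_inverse_opinv[bV _ VS].
  have <- : opinv S (S x) = x by exact: (congr1 (@^~ x) VS).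
  rewrite Sx (le_trans (le_opnorm _ bV))// ler_wpM2l ?opnorm_ge0// rnormN.
  exact: le_opnorm.
(* Here [B = 0] forces [x = 0], and both quotients are 0 whatever their denominators. *)
have [nB|nB] := eqVneq (opnorm B) 0.
  have BE : B = 0.
    apply/funext => v; apply: rnorm_le0.
    by rewrite (le_trans (le_opnorm _ bB))// nB mul0r.
  have /rnorm_le0-> : rnorm x <= 0 by rewrite (le_trans (x0 (nz BE)))// nB mul0r mulr0.
  by rewrite rnorm0 nB mulr0 !mul0e.
have Bp : 0 < opnorm B by rewrite lt_neqAle eq_sym nB.
have [->|mn] := eqVneq (spectral_sup A * kappa z A) 0.
  by rewrite inve0 gt0_muley ?leey// lte_fin mulr_gt0.
have mp : 0 < spectral_sup A * kappa z A by rewrite lt_neqAle eq_sym mn.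
have sz : ~ spectrum A z by move=> /kappa_spectrum k0; rewrite k0 mulr0 eqxx in mn.
have {}x0 := x0 sz.
(* If [y = 0] then [x = 0], and the left quotient is [0 / 0 = 0]. *)
have [yn|yn] := eqVneq (rnorm y) 0.
  have /rnorm_le0-> : rnorm x <= 0 by rewrite (le_trans x0)// yn !mulr0.
  by rewrite rnorm0 mul0e mule_ge0 ?inve_ge0 ?lee_fin ?m0// mulr_ge0.
have yp : 0 < rnorm y by rewrite lt_neqAle eq_sym yn rnorm_ge0.
have [bV _ _] := op_inverse_opinv (contrapT sz).
have kV0 : 0 <= kappa z A * opnorm (opinv S) by rewrite mulr_ge0 ?kappa_ge0 ?opnorm_ge0.
have mV : spectral_sup A * kappa z A * opnorm (opinv S) <= 2.
  rewrite -mulrA (le_trans (ler_wpM2r kV0 (spectral_sup_le z bA)))//.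
  rewrite -mulrA -[leRHS]mulr1 ler_wpM2l// mulrCA; exact: kappa_le.
rewrite !inver (negbTE yn) (negbTE mn) -!EFinM lee_fin ler_pdivrMr// mulrAC.
rewrite ler_pdivlMr// mulrC (le_trans (ler_wpM2l m0 x0))// -[leRHS]mulrA [leLHS]mulrA.
by apply: ler_wpM2r => //; rewrite mulr_ge0 ?rnorm_ge0.
Qed.

End complex_banach.

(* The quotients are taken in the extended reals, where [c / 0 = +oo] for
   [c > 0] and [0 / 0 = 0]; they are the usual ones when the denominators are
   nonzero. *)
Theorem theorem3p5 (R : realType) (X : completeNormedModType R[i])
    (A DA : X -> X) (z : R[i]) (x dx y : X) :
  bounded_op A -> bounded_op DA ->
  ~ spectrum A z ->
  A x - z *: x = y ->
  (shift_op A z + DA) (x + dx) = y ->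
  ((rnorm dx)%:E / (rnorm x)%:E <=
     (2 * opnorm DA)%:E / (spectral_sup (A + DA) * kappa z (A + DA))%:E)%E /\
  ((rnorm dx)%:E / (rnorm (x + dx))%:E <=
     (2 * opnorm DA)%:E / (spectral_sup A * kappa z A)%:E)%E.
Proof.
move=> bA bD nz Ax Sxd.
have eqS : shift_op (A + DA) z = shift_op A z + DA by rewrite /shift_op addrAC.
have bS := bounded_op_shift z bA.
have Sx : shift_op A z x = y by [].
have dxE : dx = x + dx - x by rewrite addrAC subrr add0r.
split.
(* For (1) the base operator is [A + DA]; when [DA = 0] it is [A], whose spectrum omits [z]. *)
- apply: perturbation_bound => //; first exact: bounded_opD.
    by move=> ->; rewrite addr0.
  rewrite dxE bounded_opB; last exact/bounded_op_shift/bounded_opD.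
  by rewrite eqS Sxd fctE Sx opprD addrA subrr add0r.
(* For (2) the base operator is [A], and [DA] acts on [x + dx]. *)
- apply: perturbation_bound => //.
  by rewrite {1}dxE bounded_opB// Sx -Sxd fctE opprD addrA subrr add0r.
Qed.
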